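(* Let $u_D=q_N=0$ and let $(u_h,q_h,p_h,\widehat u_h,\widehat p_h^{\,-})$ be a solution of the semi-discrete HDG method described in the context (for $F(s)=\beta s^m$). Assume that the stabilization function satisfies, at every point $x_{i-1}^+$, $i=1,\dots,N$, $$(\tau_F^+-\tilde\tau^+)-\tau_{pu}^+-\tfrac12(\tau_{qu}^+)^2\ge 0,$$ and, at every point $x_i^-$, $i=1,\dots,N$, $$(\tau_F^--\tilde\tau^-)+\tfrac12(\tau_{qu}^-)^2\ge 0,\qquad (\tau_F^--\tilde\tau^-)(\tau_{qp}^-)^2+\tau_{qu}^-\tau_{qp}^--\tfrac12\ge 0 .$$ Then $$\frac{d}{dt}\|u_h\|^2\le 2(f,u_h).$$
   Context: **Problem.** $\Omega=(a,b)$, $T>0$, $F(s)=\beta s^m$ with $\beta$ a real constant and $m\ge0$ an integer, $f(\cdot,t)\in L^2(\Omega)$. The HDG method approximates the problem $u_t+u_{xxx}+F(u)_x=f$ in $\Omega\times(0,T]$, $u=u_0$ at $t=0$, $u=u_D$ on $\partial\Omega=\{a,b\}$, $u_x=q_N$ on $\partial\Omega_N=\{b\}$, written as the system $q=u_x$, $p=q_x$, $u_t+p_x+F(u)_x=f$. **Mesh and notation.** $a=x_0<x_1<\dots<x_N=b$, $I_i=(x_{i-1},x_i)$, $\mathcal T_h=\{I_i\}_{i=1}^N$, $\mathscr E_h=\{x_i\}_{i=0}^N$, and $\partial\mathcal T_h$ is the collection of the boundaries $\partial I_i=\{x_{i-1}^+,x_i^-\}$. A function on $\partial\mathcal T_h$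 may take different values at $x_i^-$ and $x_i^+$; a function on $\mathscr E_h$ has a single value at each $x_i$. A superscript $+$ (resp. $-$) denotes values at the points $x_{i-1}^+$ (resp. $x_i^-$), $i=1,\dots,N$. For an element-wise smooth function, the values at $x_{i-1}^+$ and $x_i^-$ are the one-sided traces from inside $I_i$. The outward normal is $n(x_{i-1}^+)=-1$, $n(x_i^-)=1$. Set $(\varphi,v)=\sum_{i=1}^N\int_{I_i}\varphi v\,dx$, with element-wise derivatives, and $\langle\varphi,vn\rangle=\sum_{i=1}^N[\varphi(x_i^-)v(x_i^-)-\varphi(x_{i-1}^+)v(x_{i-1}^+)]$. $\|\cdot\|$ is the $L^2(\Omega)$ norm. **Spaces.** $W_h^k=\{w\in L^2(\Omega): w|_{I_i}\in P_k(I_i)\ \forall i\}$, where $P_k$ denotes polynomials of degree at most $k$; $M_h(g)$ is the set of functions $\zeta$ on $\mathscr E_h$ with $\zeta=g$ on $\{a,b\}$; $\tilde M_h$ is the set of functions on $\mathscr E_h\setminus\{a\}$. An element $\widehat p_h^{\,-}\in\tilde M_h$ gives the values $\widehat p_h(x_i^-)$, $i=1,\dots,N$. **HDG method (semi-discrete in time).** At each time $t$, $(u_h,q_h,p_h,\widehat u_h,\widehat p_h^{\,-})\in W_h^k\times W_h^k\times W_h^k\times M_h(u_D)\times\tilde M_h$ satisfies, for all $v,z,w\in W_h^k$, $\mu\in\tilde M_h$, $\chi\in M_h(0)$, $$(q_h,v)+(u_h,v_x)-\langle\widehat u_h,vn\rangle=0,\qquad (p_h,z)+(q_h,z_x)-\langle\widehat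 q_h,zn\rangle=0,$$ $$((u_h)_t,w)-(p_h+F(u_h),w_x)+\langle\widehat p_h+\widehat F_h,wn\rangle=(f,w),$$ $$\langle\widehat q_h,\mu n\rangle=q_N\,\mu(b),\qquad \langle\widehat p_h+\widehat F_h,\chi n\rangle=0,$$ where in the pairing with $\mu$ the point $x_0^+$ is omitted. The last two equations thus say that $\widehat q_h$ and $\widehat p_h+\widehat F_h$ are single-valued at interior nodes and $\widehat q_h(b)=q_N$. The numerical traces are $$\widehat p_h^{\,+}=p_h^++\tau_{pu}^+(\widehat u_h-u_h^+)n^+,\qquad \widehat q_h^{\,+}=q_h^++\tau_{qu}^+(\widehat u_h-u_h^+)n^+,$$ $$\widehat q_h^{\,-}=q_h^-+\tau_{qu}^-(\widehat u_h-u_h^-)n^-+\tau_{qp}^-(\widehat p_h^{\,-}-p_h^-)n^-,$$ $$\widehat F_h=F(\widehat u_h)-\tau_F(\widehat u_h,u_h)(\widehat u_h-u_h)n\quad\text{on }\partial\mathcal T_h.$$ The real-valued functions $\tau_{qu},\tau_{pu},\tau_{qp},\tau_F(\widehat u_h,u_h)$ on (the relevant parts of) $\partial\mathcal T_h$ are the components of the stabilization function; $\tau_F$ may depend nonlinearly on $\widehat u_h$ and $u_h$. **The quantity $\tilde\tau$.** On $\partial\mathcal T_h$, $$\tilde\tau=\tilde\tau(u_h,\widehat u_h)=\frac{1}{(u_h-\widehat u_h)^2}\int_{\widehat u_h}^{u_h}(F(s)-F(\widehat u_h))\,n\,ds,$$ understood as the limiting value $\tfrac12F'(\widehat u_h)n$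 at points where $u_h=\widehat u_h$. *)

(* Defs.v *)
From HB Require Import structures.
From mathcomp Require Import all_boot all_order all_algebra.
From mathcomp Require Import all_classical all_reals all_analysis.
Set Implicit Arguments.
Unset Strict Implicit.
Unset Printing Implicit Defensive.
Import Order.TTheory GRing.Theory Num.Theory.
Import numFieldNormedType.Exports.
Local Open Scope classical_set_scope.
Local Open Scope ring_scope.

(* The i-th element (i : 'I_N, numbered from 0) is ]x_i, x_{i+1}[.  A point of
   the collection of element boundaries is a pair (i, s), where s says from
   which side the node is approached: (i, Plus) is the left endpoint of the
   i-th element, approached from its right, and (i, Minus) is its right
   endpoint, approached from its left. *)
Inductive side := Plus | Minus.

Section Mesh.
Variables (R : realType) (N : nat).

Definition bfun := 'I_N -> side -> R.

Definition nfun := 'I_N.+1 -> R.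

Definition node (i : 'I_N) (s : side) : 'I_N.+1 :=
  match s with Plus => widen_ord (leqnSn N) i | Minus => lift ord0 i end.

Definition normal : bfun := fun _ s => match s with Plus => -1 | Minus => 1 end.

Definition is_mesh (a b : R) (x : nfun) : Prop :=
  [/\ x ord0 = a, x ord_max = b & forall i, x (node i Plus) < x (node i Minus)].

Definition elt (x : nfun) (i : 'I_N) : set R :=
  `]x (node i Plus), x (node i Minus)[.

Definition to_bfun (zeta : nfun) : bfun := fun i s => zeta (node i s).

Definition trace (x : nfun) (w : R -> R) : bfun := fun i s =>
  match s with
  | Plus => lim (w y @[y --> (x (node i Plus))^'+])
  | Minus => lim (w y @[y --> (x (node i Minus))^'-])
  end.

Definition inner (x : nfun) (phi v : R -> R) : R :=
  \sum_(i < N) \int[lebesgue_measure]_(y in elt x i) (phi y * v y).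

Definition bracket (phi v : bfun) : R :=
  \sum_(i < N) (phi i Minus * v i Minus * normal i Minus
                + phi i Plus * v i Plus * normal i Plus).

(* Functions on the nodes other than a are represented as 'I_N -> R, where i
   stands for the right endpoint of the i-th element. *)
Definition ext0 (mu : 'I_N -> R) : nfun := fun j =>
  if unlift ord0 j is Some i then mu i else 0.

End Mesh.

Section Spaces.
Variable R : realType.

Definition L2norm (a b : R) (w : R -> R) : R :=
  fine ('N[lebesgue_measure]_2%:E [EFin \o (w \* \1_(`]a, b[))%R])%E.

Definition L2 (a b : R) (w : R -> R) : Prop :=
  measurable_fun `]a, b[ w /\
  ('N[lebesgue_measure]_2%:E [EFin \o (w \* \1_(`]a, b[))%R] < +oo)%E.

(* Values of w outside the open elements are irrelevant: members of W_h^k are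
   only used through integrals over elements and one-sided traces. *)
Definition Wh (N : nat) (a b : R) (x : nfun R N) (k : nat) (w : R -> R) : Prop :=
  L2 a b w /\
  forall i : 'I_N, exists p : {poly R},
    (size p <= k.+1)%N /\ forall y, elt x i y -> w y = p.[y].

Definition Mh (N : nat) (a b : R) (g : R -> R) (zeta : nfun R N) : Prop :=
  zeta ord0 = g a /\ zeta ord_max = g b.

(* Time derivatives on ]0, T]: two-sided for 0 < t < T, from the left at T. *)
Definition tquot (T : R) (g : R -> R) (t : R) :=
  (g s - g t) / (s - t) @[s --> within `]0, T] t^'].

Definition tderivable (T : R) (g : R -> R) (t : R) : Prop :=
  cvg (tquot T g t).

Definition tderiv (T : R) (g : R -> R) (t : R) : R := lim (tquot T g t).

(* Oriented integral from c to d. *)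
Definition oint (c d : R) (g : R -> R) : R :=
  if c <= d then \int[lebesgue_measure]_(s in `[c, d]) g s
  else - \int[lebesgue_measure]_(s in `[d, c]) g s.

Definition flux (beta : R) (m : nat) (s : R) : R := beta * s ^+ m.

End Spaces.

(* tau_qu and tau_F live on all element boundaries, tau_pu only on the points
   (i, Plus), tau_qp only on the points (i, Minus).  tau_F may depend on the
   pair (uhat_h, u_h) in an arbitrary way. *)
Record stabilization (R : realType) (N : nat) := Stabilization {
  tau_qu : bfun R N;
  tau_pu : 'I_N -> R;
  tau_qp : 'I_N -> R;
  tau_F : nfun R N -> (R -> R) -> bfun R N
}.

Section Method.
Variables (R : realType) (N : nat) (x : nfun R N) (beta : R) (m : nat).
Variable tau : stabilization R N.
Notation F := (flux beta m).
Local Notation n := (@normal R N).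

Definition p_hat (u p : R -> R) (uh : nfun R N) (phm : 'I_N -> R) : bfun R N :=
  fun i s => match s with
  | Plus => trace x p i Plus
      + tau_pu tau i * (to_bfun uh i Plus - trace x u i Plus) * n i Plus
  | Minus => phm i
  end.

Definition q_hat (u q p : R -> R) (uh : nfun R N) (phm : 'I_N -> R) : bfun R N :=
  fun i s => match s with
  | Plus => trace x q i Plus
      + tau_qu tau i Plus * (to_bfun uh i Plus - trace x u i Plus) * n i Plus
  | Minus => trace x q i Minus
      + tau_qu tau i Minus * (to_bfun uh i Minus - trace x u i Minus) * n i Minus
      + tau_qp tau i * (phm i - trace x p i Minus) * n i Minus
  end.

Definition F_hat (u : R -> R) (uh : nfun R N) : bfun R N := fun i s =>
  F (to_bfun uh i s)
  - tau_F tau uh u i s * (to_bfun uh i s - trace x u i s) * n i s.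

Definition tau_tilde (u : R -> R) (uh : nfun R N) : bfun R N := fun i s =>
  let u0 := trace x u i s in
  let uh0 := to_bfun uh i s in
  if u0 == uh0 then 2^-1 * derive1 F uh0 * n i s
  else ((u0 - uh0) ^+ 2)^-1 * oint uh0 u0 (fun r => (F r - F uh0) * n i s).

(* The five equations at a fixed time; ut is the time derivative of u_h.  Test
   functions mu on the nodes other than a are extended by 0 to a, which is the
   omission of the point x_0^+ from the pairing with mu. *)
Definition hdg_equations (a b : R) (k : nat) (f : R -> R) (qN : R)
    (u ut q p : R -> R) (uh : nfun R N) (phm : 'I_N -> R) : Prop :=
  let qhat := q_hat u q p uh phm in
  let pFhat := fun i s => p_hat u p uh phm i s + F_hat u uh i s in
  [/\ forall v, Wh a b x k v ->
        inner x q v + inner x u (derive1 v) - bracket (to_bfun uh) (trace x v) = 0,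
      forall z, Wh a b x k z ->
        inner x p z + inner x q (derive1 z) - bracket qhat (trace x z) = 0,
      forall w, Wh a b x k w ->
        inner x ut w - inner x (fun y => p y + F (u y)) (derive1 w)
        + bracket pFhat (trace x w) = inner x f w,
      forall mu : 'I_N -> R,
        bracket qhat (to_bfun (ext0 mu)) = qN * ext0 mu ord_max
    & forall chi : nfun R N, Mh a b (fun=> 0) chi ->
        bracket pFhat (to_bfun chi) = 0].

(* The functions of time and space u, q, p, f take time as first argument. *)
Definition hdg_solution (a b T : R) (k : nat) (f uD : R -> R -> R) (qN : R -> R)
    (u q p : R -> R -> R) (uh : R -> nfun R N) (phm : R -> 'I_N -> R) : Prop :=
  forall t, 0 < t <= T ->
  [/\ [/\ Wh a b x k (u t), Wh a b x k (q t) & Wh a b x k (p t)],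
      Mh a b (uD t) (uh t),
      forall (i : 'I_N) y, elt x i y -> tderivable T (u^~ y) t
    & hdg_equations a b k (f t) (qN t)
        (u t) (fun y => tderiv T (u^~ y) t) (q t) (p t) (uh t) (phm t)].

End Method.

(* Main.v *)
Require Import Defs.
From mathcomp Require Import all_boot all_order all_algebra.
From mathcomp Require Import all_classical all_reals all_analysis.
From mathcomp Require Import measurable_realfun.
From mathcomp Require Import ring lra.
Set Implicit Arguments.
Unset Strict Implicit.
Unset Printing Implicit Defensive.
Import Order.TTheory GRing.Theory Num.Theory.
Import numFieldNormedType.Exports.
Local Open Scope classical_set_scope.
Local Open Scope ring_scope.

(** The proof is the energy method. On each element [u], [q], [p] are
polynomials, so every integral of a derivative is a difference of end values.
Testing the first equation with [p], the second with [q], the third with [u]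
and the last with [uh] (which vanishes at both ends of the domain), and
eliminating the volume terms, leaves
  (f, u) - (u_t, u) = < D, n > - 1/2 < qh^2, n >,
where, with e = u - uh and G' = F,
  D = (ph - p) e + 1/2 (q - qh)^2 + Fh e - (G(u) - G(uh))
([energy_identity]). The right side is nonnegative for two reasons.

First, < qh^2, n > <= 0: the fourth equation makes [qh] single-valued inside
and zero at b, so only - qh(a)^2 survives ([bracket_self_le0]).

Second, D n >= 0 at every boundary point. By definition of tau_tilde,
G(u) - G(uh) = F(uh) e + tau_tilde e^2 n, so D n is a quadratic form in the
jumps. At a left endpoint the formulas for the traces turn it into
  (tau_F - tau_tilde - tau_pu - 1/2 tau_qu^2) e^2.
At a right endpoint, with d = ph - p, it is
  (tau_F - tau_tilde) e^2 + d e + 1/2 (tau_qu e - tau_qp d)^2,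
whose discriminant condition is the last hypothesis on the stabilization
([quadratic_form_ge0]).

It remains to know that 2 (u_t, u) is the derivative of the squared norm, when
[u] is only assumed differentiable in time at each fixed point of space. Since
[u] has degree at most k on each element, it is the Lagrange interpolant of its
values at k + 1 fixed points; hence the squared norm is a fixed quadratic form
in finitely many functions of time, which can be differentiated term by term
([tquot_L2norm_sqr]). *)

(** * Integrals, one-sided limits and derivatives of polynomials *)

Section PolynomialCalculus.
Variable R : realType.
Implicit Types (P Q : {poly R}) (c d : R).
Local Notation mu := (@lebesgue_measure R).

Lemma integrable_horner P c d : mu.-integrable `]c, d[ (EFin \o horner P).
Proof.
have iP : mu.-integrable `[c, d] (EFin \o horner P).
  apply: continuous_compact_integrable; first exact: segment_compact.
  by apply: continuous_subspaceT => y; exact: continuous_horner.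
by apply: integrableS iP => //; exact: subset_itv_oo_cc.
Qed.

Lemma Rintegral_horner_deriv_cc P c d : c < d ->
  \int[mu]_(y in `[c, d]) (P^`()).[y] = P.[d] - P.[c].
Proof.
move=> cd; rewrite /Rintegral (@continuous_FTC2 _ _ (horner P))//.
- by apply: continuous_subspaceT => y; exact: continuous_horner.
- split=> [y _||]; first exact: derivable_horner.
  + by apply: cvg_at_right_filter; exact: continuous_horner.
  + by apply: cvg_at_left_filter; exact: continuous_horner.
- by move=> y _; rewrite derivE.
Qed.

Lemma Rintegral_horner_deriv P c d : c < d ->
  \int[mu]_(y in `]c, d[) (P^`()).[y] = P.[d] - P.[c].
Proof.
move=> cd; rewrite -Rintegral_horner_deriv_cc// /Rintegral.
rewrite [RHS](_ : _ = fine (\int[mu]_(x in `]c, d[) (P^`().[x])%:E)%E)//.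
congr fine; apply: integral_itv_bndoo.
by have /integrableP[] := integrable_horner P^`() c d.
Qed.

(** The orientation convention removes any order condition on the endpoints. *)
Lemma oint_horner_deriv P c d :
  oint c d (fun y => (P^`()).[y]) = P.[d] - P.[c].
Proof.
rewrite /oint; have [cd|dc|->] := ltgtP c d.
- exact: Rintegral_horner_deriv_cc.
- by rewrite Rintegral_horner_deriv_cc// opprB.
- by rewrite set_itv1 Rintegral_set1 subrr.
Qed.

Lemma derive1_eq_horner (w : R -> R) P c d y :
  (forall z, c < z < d -> w z = P.[z]) -> c < y < d ->
  derive1 w y = (P^`()).[y].
Proof.
move=> wP ycd; rewrite derivE !derive1E; apply: near_eq_derive.
have : y \in `]c, d[ by rewrite in_itv.
move/near_in_itvoo; apply: filterS => z /=.
by rewrite in_itv /=; exact: wP.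
Qed.

Lemma lim_at_right_horner (w : R -> R) P c d : c < d ->
  (forall z, c < z < d -> w z = P.[z]) -> lim (w y @[y --> c^'+]) = P.[c].
Proof.
move=> cd wP; apply: cvg_lim => //.
have Pc : P.[y] @[y --> c^'+] --> P.[c].
  by apply: cvg_at_right_filter; exact: continuous_horner.
apply: cvg_trans Pc; apply: near_eq_cvg; near=> y.
by rewrite wP//; apply/andP; split; near: y;
  [exact: nbhs_right_gt|exact: nbhs_right_lt].
Unshelve. all: by end_near. Qed.

Lemma lim_at_left_horner (w : R -> R) P c d : c < d ->
  (forall z, c < z < d -> w z = P.[z]) -> lim (w y @[y --> d^'-]) = P.[d].
Proof.
move=> cd wP; apply: cvg_lim => //.
have Pd : P.[y] @[y --> d^'-] --> P.[d].
  by apply: cvg_at_left_filter; exact: continuous_horner.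
apply: cvg_trans Pd; apply: near_eq_cvg; near=> y.
by rewrite wP//; apply/andP; split; near: y;
  [exact: nbhs_left_gt|exact: nbhs_left_lt].
Unshelve. all: by end_near. Qed.

End PolynomialCalculus.

(** * Time derivatives along the filter of difference quotients *)

Section TimeDerivative.
Variables (R : realType) (T t : R).
Hypothesis ht : 0 < t <= T.
Implicit Types (g h : R -> R) (l : R).
Local Notation F := (within `]0, T] t^').

(** The left half of every punctured neighbourhood of t meets the time interval,
even at t = T; properness makes derivatives unique. *)
Lemma within_dnbhs_proper : ProperFilter F.
Proof.
apply: Build_ProperFilter_ex => A.
rewrite /within /= nearE => -[e /= e0 eA].
have /andP[t0 tT] := ht.
have m0 : 0 < Num.min e t by rewrite lt_min e0.
have me : Num.min e t <= e by rewrite ge_min lexx.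
have mt : Num.min e t <= t by rewrite ge_min lexx orbT.
(* This point is closer to t than e, and still positive. *)
exists (t - Num.min e t / 2); apply: eA => /=.
- by rewrite opprB addrC subrK gtr0_norm; lra.
- by apply/eqP; lra.
- by rewrite in_itv /=; apply/andP; split; lra.
Qed.
Local Instance F_proper : ProperFilter F := within_dnbhs_proper.

Lemma tquot_lim (g : R -> R) l : tquot T g t --> l ->
  tderivable T g t /\ tderiv T g t = l.
Proof. by move=> gl; split; [apply/cvg_ex; exists l|exact: cvg_lim]. Qed.

Lemma eq_tquot (g h : R -> R) l : (forall s, 0 < s <= T -> g s = h s) ->
  tquot T h t --> l -> tquot T g t --> l.
Proof.
move=> gh; apply: cvg_trans; apply: near_eq_cvg; near=> s.
rewrite gh//; first by rewrite gh//.
suff : s \in `]0, T] by rewrite in_itv.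
by near: s; apply: withinT.
Unshelve. all: by end_near. Qed.

(** Differentiability at t forces continuity along the same filter, as needed
for the product rule. *)
Lemma tquot_cvg (g : R -> R) l : tquot T g t --> l -> g s @[s --> F] --> g t.
Proof.
move=> gl.
have -> : g t = l * (t - t) + g t by rewrite subrr mulr0 add0r.
have idt : s @[s --> F] --> t.
  by apply: cvg_within_filter; apply: cvg_within_filter; exact: cvg_id.
have : ((g s - g t) / (s - t)) * (s - t) + g t @[s --> F]
    --> l * (t - t) + g t.
  by apply: cvgD; [apply: cvgM => //; apply: cvgB => //|]; exact: cvg_cst.
apply: cvg_trans; apply: near_eq_cvg; near=> s.
rewrite divfK ?subrK// subr_eq0.
by near: s; apply: cvg_within; exact: (@nbhs_dnbhs_neq R).
Unshelve. all: by end_near. Qed.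

Lemma tquotM (g h : R -> R) l l' : tquot T g t --> l -> tquot T h t --> l' ->
  tquot T (fun s => g s * h s) t --> l * h t + g t * l'.
Proof.
move=> gl hl.
have : (g s - g t) / (s - t) * h s + g t * ((h s - h t) / (s - t)) @[s --> F]
    --> l * h t + g t * l'.
  apply: cvgD; first by apply: cvgM => //; exact: tquot_cvg hl.
  by apply: cvgM => //; exact: cvg_cst.
apply: cvg_trans; apply: near_eq_cvg; apply: nearW => s; ring.
Qed.

Lemma tquotZ (g : R -> R) l r : tquot T g t --> l ->
  tquot T (fun s => g s * r) t --> l * r.
Proof.
move=> gl; have : (g s - g t) / (s - t) * r @[s --> F] --> l * r.
  by apply: cvgM => //; exact: cvg_cst.
by apply: cvg_trans; apply: near_eq_cvg; apply: nearW => s; ring.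
Qed.

Lemma tquot_sum (I : finType) (g : I -> R -> R) (l : I -> R) :
  (forall i, tquot T (g i) t --> l i) ->
  tquot T (fun s => \sum_i g i s) t --> \sum_i l i.
Proof.
move=> gl; have : \sum_i ((g i s - g i t) / (s - t)) @[s --> F] --> \sum_i l i.
  by apply: cvg_big => [|i _]; [exact: add_continuous|exact: gl].
apply: cvg_trans; apply: near_eq_cvg; apply: nearW => s.
by rewrite -sumrB mulr_suml.
Qed.

End TimeDerivative.

(** * Piecewise polynomials on the mesh *)

Section Mesh.
Variables (R : realType) (N : nat) (a b : R) (x : nfun R N).
Hypothesis hx : is_mesh a b x.
Local Notation mu := (@lebesgue_measure R).

(** Only the values inside the open elements matter, so nothing is asked at the
nodes. *)
Definition represents (w : R -> R) (P : 'I_N -> {poly R}) : Prop :=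
  forall i y, elt x i y -> w y = (P i).[y].

Lemma Wh_represents k w : Wh a b x k w ->
  exists P : 'I_N -> {poly R},
    (forall i, (size (P i) <= k.+1)%N) /\ represents w P.
Proof.
case=> _ /choice[P HP]; exists P.
by split=> [i|i y]; [case: (HP i)|case: (HP i) => _; exact].
Qed.

Lemma mesh_lt i : x (node i Plus) < x (node i Minus).
Proof. by case: hx. Qed.

Lemma trace_represents w P : represents w P ->
  trace x w = fun i s => (P i).[x (node i s)].
Proof.
move=> wP; apply/funext => i; apply/funext => -[] /=.
- apply: (lim_at_right_horner (mesh_lt i)) => z zi.
  by apply: wP; rewrite /elt /= in_itv.
- apply: (lim_at_left_horner (mesh_lt i)) => z zi.
  by apply: wP; rewrite /elt /= in_itv.
Qed.

Lemma derive1_represents w P : represents w P ->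
  represents (derive1 w) (fun i => (P i)^`()).
Proof.
move=> wP i y; rewrite /elt /= in_itv /= => yi.
apply: derive1_eq_horner yi => z zi.
by apply: wP; rewrite /elt /= in_itv.
Qed.

Definition elt_int i (P : {poly R}) : R := \int[mu]_(y in elt x i) P.[y].

Lemma elt_intD i (P Q : {poly R}) :
  elt_int i (P + Q) = elt_int i P + elt_int i Q.
Proof.
rewrite /elt_int /elt -RintegralD//; [|exact: integrable_horner..].
by apply: eq_Rintegral => y _; rewrite hornerD.
Qed.

Lemma elt_intZ i c (P : {poly R}) : elt_int i (c *: P) = c * elt_int i P.
Proof.
rewrite /elt_int /elt -RintegralZl//; [|exact: integrable_horner].
by apply: eq_Rintegral => y _; rewrite hornerZ.
Qed.

Lemma elt_int_sum i (I : finType) (P : I -> {poly R}) :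
  elt_int i (\sum_j P j) = \sum_j elt_int i (P j).
Proof.
apply: (big_morph (elt_int i) (elt_intD i)).
by rewrite -(scale0r 0) elt_intZ mul0r.
Qed.

Lemma elt_int_deriv i P :
  elt_int i P^`() = P.[x (node i Minus)] - P.[x (node i Plus)].
Proof. by apply: Rintegral_horner_deriv; exact: mesh_lt. Qed.

Lemma inner_represents w v P Q : represents w P -> represents v Q ->
  inner x w v = \sum_i elt_int i (P i * Q i).
Proof.
move=> wP vQ; apply: eq_bigr => i _; apply: eq_Rintegral => y.
by rewrite inE => yi; rewrite hornerM (wP i)// (vQ i).
Qed.

(** The interior division points form a null set; induction adds one interval at
a time. *)
Lemma integral_subdivision (z : nat -> R) (g : R -> R) n :
  (forall j, (j < n)%N -> z j < z j.+1) ->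
  measurable_fun `]z 0%N, z n[ g -> (forall y, 0 <= g y) ->
  (\int[mu]_(y in `](z 0%N), (z n)[) (g y)%:E =
   \sum_(j < n) \int[mu]_(y in `](z j), (z j.+1)[) (g y)%:E)%E.
Proof.
move=> zlt mg g0; elim: n zlt mg => [|n IHn] zlt mg.
  by rewrite big_ord0 set_itv_ge ?bnd_simp ?ltxx// integral_set0.
have z0n : z 0%N <= z n.
  elim: n {IHn mg} zlt => // n IHn zlt.
  apply: le_trans (ltW (zlt _ _)) => //.
  by apply: IHn => j jn; apply: zlt; rewrite ltnS ltnW.
have znS : z n < z n.+1 by exact: zlt.
have E : `]z 0%N, z n.+1[%classic = `]z 0%N, z n] `|` `]z n, z n.+1[ :> set R.
  by rewrite -itv_bndbnd_setU// bnd_simp.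
rewrite big_ord_recr /= -IHn; first last.
- by apply: measurable_funS mg => //; rewrite E => y /subset_itv_oo_oc; left.
- by move=> j jn; apply: zlt; rewrite ltnS ltnW.
rewrite E ge0_integral_setU//; first last.
- apply/disj_setPS => y [/=]; rewrite !in_itv /= => /andP[_ yn] /andP[].
  by rewrite ltNge yn.
- by move=> y _; rewrite lee_fin.
- by rewrite -E; exact/measurable_EFinP.
congr (_ + _)%E; apply: integral_itv_bndoo; apply/measurable_EFinP.
by apply: measurable_funS mg => //; rewrite E => y /subset_itv_oo_oc; left.
Qed.

Lemma L2norm_sqr (w : R -> R) P : measurable_fun `]a, b[ w -> represents w P ->
  L2norm a b w ^+ 2 = \sum_i elt_int i (P i ^+ 2).
Proof.
move=> mw wP; rewrite /L2norm -powR_mulrn ?fine_ge0 ?Lnorm_ge0//.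
rewrite -fine_poweR poweR_Lnorm//.
have -> : (\int[mu]_y (`|(EFin \o (w \* \1_(`]a, b[))%R) y| `^ 2) =
    \int[mu]_(y in `]a, b[) (w y ^+ 2)%:E)%E.
  rewrite [RHS]integral_mkcond; apply: eq_integral => y _ /=.
  rewrite /patch indicE; case: ifPn => yab.
    by rewrite mulr1 (powR_mulrn 2) ?normr_ge0// real_normK ?num_real.
  by rewrite mulr0 normr0 powR0.
have [xa xb _] := hx.
pose z j := x (inord j).
have za : z 0%N = a by rewrite -xa; congr x; apply: val_inj; rewrite /= inordK.
have zb : z N = b by rewrite -xb; congr x; apply: val_inj; rewrite /= inordK.
have zP (i : 'I_N) : z i = x (node i Plus).
  by congr x; apply: val_inj; rewrite /= inordK // ltnS ltnW.
have zM (i : 'I_N) : z i.+1 = x (node i Minus).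
  by congr x; apply: val_inj; rewrite /= inordK // ltnS.
rewrite -za -zb (integral_subdivision (g := fun y => w y ^+ 2)); first last.
- by move=> y; rewrite sqr_ge0.
- by rewrite za zb; exact: measurable_funX.
- move=> j jN; have /= := mesh_lt (Ordinal jN).
  by rewrite -(zP (Ordinal jN)) -(zM (Ordinal jN)).
under eq_bigr => i _.
  rewrite zP zM.
  rewrite (_ : integral _ _ _ = (elt_int i (P i ^+ 2))%:E); last first.
    rewrite fineK; last first.
      rewrite /elt; apply: integrable_fin_num => //.
      exact: integrable_horner.
    by apply: eq_integral => y /[1!inE] yi; rewrite (wP i)// horner_exp.
  over.
by rewrite sumEFin.
Qed.

End Mesh.

(** * Interpolation on each element and the derivative of the energy *)

Section Interpolation.
Variables (R : realType) (N : nat) (a b : R) (x : nfun R N) (k : nat).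
Hypothesis hx : is_mesh a b x.
Implicit Types (g h : R -> R).

(** Infinitely many distinct interior points of the i-th element: the Lagrange
basis takes its nodes from an injective sequence. *)
Definition sample (i : 'I_N) (j : nat) : R :=
  x (node i Plus) + (x (node i Minus) - x (node i Plus)) / j.+2%:R.

Lemma elt_sample i j : elt x i (sample i j).
Proof.
have xi := mesh_lt hx i.
rewrite /elt /sample /= in_itv /= ltrDl divr_gt0 ?subr_gt0//=.
by rewrite -ltrBrDl gtr_pMr ?subr_gt0// invf_lt1// ltr1n.
Qed.

Lemma sample_inj i : injective (sample i).
Proof.
move=> j l /addrI/mulfI; rewrite subr_eq0 gt_eqF ?(mesh_lt hx)// => /(_ isT).
by move=> /invr_inj/eqP; rewrite eqr_nat => /eqP[].
Qed.

Definition elt_lagrange i (j : 'I_k.+1) : {poly R} :=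
  tnth (lagrange k.+1 (sample i)) j.

Definition interp i g : {poly R} :=
  \sum_(j < k.+1) g (sample i j) *: elt_lagrange i j.

(** A polynomial of degree at most k is determined by k + 1 values, so the
coefficients of [g] in a fixed basis are values of [g] itself. *)
Lemma Wh_interp g : Wh a b x k g -> represents x g (interp^~ g).
Proof.
case/Wh_represents=> P [sP gP] i y yi; rewrite (gP _ _ yi).
rewrite (lagrange_gen _ (@sample_inj i) (sP i))// /interp; congr (_.[y]).
by apply: eq_bigr => j _; rewrite mul_polyC (gP i)//; exact: elt_sample.
Qed.

Lemma elt_int_interpM i g h :
  elt_int x i (interp i g * interp i h) =
  \sum_(j < k.+1) \sum_(l < k.+1)
    g (sample i j) * h (sample i l)
      * elt_int x i (elt_lagrange i j * elt_lagrange i l).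
Proof.
rewrite /interp mulr_suml elt_int_sum; apply: eq_bigr => j _.
rewrite mulr_sumr elt_int_sum; apply: eq_bigr => l _.
by rewrite -scalerAl -scalerAr scalerA elt_intZ.
Qed.

End Interpolation.

Section EnergyDerivative.
Variables (R : realType) (N : nat) (a b T t : R) (x : nfun R N) (k : nat).
Variable u : R -> R -> R.
Hypotheses (hx : is_mesh a b x) (ht : 0 < t <= T).
Hypothesis uW : forall s, 0 < s <= T -> Wh a b x k (u s).
Hypothesis ud : forall i y, elt x i y -> tderivable T (u^~ y) t.

(** Interpolation turns the pointwise time derivative into a finite linear
combination of derivatives at the sample points: it is again a piecewise
polynomial. *)
Lemma tderiv_represents :
  represents x (fun y => tderiv T (u^~ y) t)
    (fun i => interp x k i (fun y => tderiv T (u^~ y) t)).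
Proof.
move=> i y yi; rewrite /interp horner_sum.
apply: (proj2 (tquot_lim ht _)).
apply: (eq_tquot ht (h := fun s => \sum_(j < k.+1)
    u s (sample x i j) * (elt_lagrange x i j).[y])).
  move=> s hs; rewrite (Wh_interp hx (uW hs) yi) /interp horner_sum.
  by apply: eq_bigr => j _; rewrite hornerZ.
apply: tquot_sum => // j; rewrite hornerZ; apply: tquotZ => //.
exact: ud (elt_sample hx i j).
Qed.

(** In the Lagrange basis the squared norm is a symmetric quadratic form, with
coefficients independent of time, in the values of [u] at the sample points. *)
Lemma tquot_L2norm_sqr :
  tquot T (fun s => L2norm a b (u s) ^+ 2) t -->
  2 * inner x (fun y => tderiv T (u^~ y) t) (u t).
Proof.
rewrite (inner_represents tderiv_represents (Wh_interp hx (uW ht))).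
apply: (eq_tquot ht (h := fun s => \sum_i \sum_(j < k.+1) \sum_(l < k.+1)
    u s (sample x i j) * u s (sample x i l)
      * elt_int x i (elt_lagrange x (k := k) i j * elt_lagrange x i l))).
  move=> s hs; have [[us _] _] := uW hs.
  rewrite (L2norm_sqr hx us (Wh_interp hx (uW hs))).
  by apply: eq_bigr => i _; rewrite expr2 elt_int_interpM.
rewrite mulr_sumr; apply: tquot_sum => // i.
rewrite mulr_natl mulr2n {2}mulrC 2!elt_int_interpM -big_split /=.
apply: tquot_sum => // j; rewrite -big_split /=; apply: tquot_sum => // l.
rewrite -mulrDl; apply: tquotZ => //.
by apply: tquotM => //; exact: ud (elt_sample hx _ _).
Qed.

End EnergyDerivative.

(** * Identities for the boundary pairing *)

Section Brackets.
Variables (R : realType) (N : nat).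
Implicit Types (g : nfun R N) (v : bfun R N).

Lemma bracket_telescope g :
  bracket (to_bfun g) (fun _ _ => 1) = g ord_max - g ord0.
Proof.
rewrite /bracket /to_bfun /normal /=.
under eq_bigr do rewrite !mulr1 mulrN1.
rewrite sumrB.
have : \sum_(j < N.+1) g j = \sum_(j < N.+1) g j by [].
by rewrite {1}big_ord_recl big_ord_recr /=; lra.
Qed.

(** Take for mu the left-sided values of v and let g be its extension by 0 to
the first node. The hypothesis says < v, g n > = 0, and
(v^2 + g^2) n <= 2 v g n at every point: with equality at right endpoints, where
v = g, and by 2 v g <= v^2 + g^2 at left endpoints, where n = -1. Summing,
< v^2, n > <= - < g^2, n >, which telescopes to minus the square of the last
value of g. *)
Lemma bracket_self_le0 v :
  (forall mu : 'I_N -> R, bracket v (to_bfun (ext0 mu)) = 0) ->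
  bracket v v <= 0.
Proof.
move=> hv; pose g := ext0 (v^~ Minus).
have gM i : g (node i Minus) = v i Minus by rewrite /g /ext0 /= liftK.
have g0 : g ord0 = 0 by rewrite /g /ext0 unlift_none.
have E1 := hv (v^~ Minus); rewrite -/g in E1.
have E2 := bracket_telescope (fun j => g j ^+ 2).
rewrite g0 expr0n subr0 in E2.
have gN := sqr_ge0 (g ord_max).
have : bracket v v + bracket (to_bfun (fun j => g j ^+ 2)) (fun _ _ => 1)
    <= 2 * bracket v (to_bfun g).
  rewrite /bracket -big_split /= mulr_sumr; apply: ler_sum => i _.
  rewrite /to_bfun /normal gM.
  by have := sqr_ge0 (v i Plus - g (node i Plus)); nra.
by rewrite E1 E2; lra.
Qed.

(** Completing the square in q - qh and pairing everything with u - uh; the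
right side has the pairings that the scheme and integration by parts give. *)
Lemma bracket_dissipation (u p q uh ph qh Fh G Gh : bfun R N) :
  bracket (fun i s => (ph i s - p i s) * (u i s - uh i s)
      + 2^-1 * (q i s - qh i s) ^+ 2 + Fh i s * (u i s - uh i s)
      - (G i s - Gh i s)) (fun _ _ => 1) =
  bracket (fun i s => ph i s + Fh i s) u
  - bracket (fun i s => ph i s + Fh i s) uh
  - bracket G (fun _ _ => 1) + bracket Gh (fun _ _ => 1)
  - bracket u p + bracket uh p
  + 2^-1 * bracket q q - bracket qh q + 2^-1 * bracket qh qh.
Proof.
rewrite /bracket !mulr_sumr -!sumrN -!big_split; apply: eq_bigr => i _.
by rewrite /normal /=; field.
Qed.

End Brackets.

(** * Energy identity and sign of the boundary terms *)

Section Stability.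
Variables (R : realType) (N : nat) (a b : R) (x : nfun R N).
Variables (beta : R) (m : nat).
Hypothesis hx : is_mesh a b x.
Implicit Types (tau : stabilization R N).

Definition flux_poly : {poly R} := beta *: 'X^m.
Definition flux_primitive : {poly R} := (beta / m.+1%:R) *: 'X^(m.+1).

Lemma horner_flux_poly s : flux_poly.[s] = flux beta m s.
Proof. by rewrite /flux_poly hornerZ hornerXn. Qed.

Lemma deriv_flux_primitive : flux_primitive^`() = flux_poly.
Proof.
rewrite /flux_primitive derivZ derivXn /= -scalerMnr scalerMnl.
by rewrite -[_ *+ m.+1]mulr_natr divfK// pnatr_eq0.
Qed.

(** The factor (u - uh)^2 cancels the denominator of tau_tilde; in the degenerate
case u = uh it makes both sides vanish, whatever value tau_tilde is given. *)
Lemma tau_tilde_sqr (w : R -> R) (uh : nfun R N) i s :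
  tau_tilde x beta m w uh i s * (trace x w i s - to_bfun uh i s) ^+ 2 =
  (flux_primitive.[trace x w i s] - flux_primitive.[to_bfun uh i s]
   - flux beta m (to_bfun uh i s) * (trace x w i s - to_bfun uh i s))
  * normal R i s.
Proof.
rewrite /tau_tilde; set c := trace x w i s; set d := to_bfun uh i s.
case: eqVneq => [->|cd]; first by rewrite !subrr expr0n !mulr0 subrr mul0r.
have -> : (fun r => (flux beta m r - flux beta m d) * normal R i s) =
    (fun r => (normal R i s *: (flux_primitive - flux beta m d *: 'X))^`().[r]).
  apply/funext => r.
  rewrite derivZ derivB deriv_flux_primitive derivZ derivX.
  rewrite !(hornerE, horner_flux_poly).
  by rewrite mulrC.
rewrite oint_horner_deriv mulrAC mulVf ?mul1r ?sqrf_eq0 ?subr_eq0//.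
by rewrite !hornerE; ring.
Qed.

(** The hypothesis forces r <> 0. Multiplied by r^2, the form is the hypothesis
times e^2 plus half the square of r^2 d + (1 - c r) e. *)
Lemma quadratic_form_ge0 (A r c d e : R) : 0 <= A * r ^+ 2 + c * r - 2^-1 ->
  0 <= A * e ^+ 2 + d * e + 2^-1 * (c * e - r * d) ^+ 2.
Proof.
move=> H; have r0 : 0 < r ^+ 2.
  rewrite lt0r sqr_ge0 andbT sqrf_eq0; apply: contraTneq H => ->.
  by rewrite expr0n !mulr0 addr0 add0r oppr_ge0 -ltNge invr_gt0.
rewrite -(pmulr_lge0 _ r0).
have -> : (A * e ^+ 2 + d * e + 2^-1 * (c * e - r * d) ^+ 2) * r ^+ 2 =
  (A * r ^+ 2 + c * r - 2^-1) * e ^+ 2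
  + 2^-1 * (r ^+ 2 * d + (1 - c * r) * e) ^+ 2 by field.
by rewrite addr_ge0// mulr_ge0// sqr_ge0.
Qed.

Section FixedTime.
Variables (tau : stabilization R N) (k : nat) (f u ut q p : R -> R).
Variables (uh : nfun R N) (phm : 'I_N -> R).
Hypotheses (uW : Wh a b x k u) (qW : Wh a b x k q) (pW : Wh a b x k p).
Hypothesis uhM : Mh a b (fun=> 0) uh.
Hypothesis heqs : hdg_equations x beta m tau a b k f 0 u ut q p uh phm.

Let jump : bfun R N := fun i s => trace x u i s - to_bfun uh i s.
Let qhat := q_hat x tau u q p uh phm.
Let phat := p_hat x tau u p uh phm.

(** The boundary density that, together with - 1/2 qh^2, remains after all volume
terms have been eliminated. The factor n is left out, so the sign is opposite at
the two ends of an element. *)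
Definition dissipation : bfun R N := fun i s =>
  (phat i s - trace x p i s) * jump i s
  + 2^-1 * (trace x q i s - qhat i s) ^+ 2
  + F_hat x beta m tau u uh i s * jump i s
  - (flux_primitive.[trace x u i s] - flux_primitive.[to_bfun uh i s]).

(** Eliminate (q, p), (u, p_x), (q, q_x) and (p, u_x) between the equations
tested with p, q and u. The pairing with [uh] and the telescoping sum of G(uh)
vanish because [uh] is zero at a and at b. *)
Lemma energy_identity :
  inner x f u - inner x ut u =
  bracket dissipation (fun _ _ => 1) - 2^-1 * bracket qhat qhat.
Proof.
have [U [_ uU]] := Wh_represents uW.
have [Q [_ qQ]] := Wh_represents qW.
have [P [_ pP]] := Wh_represents pW.
have [E1 E2 E3 E4 E5] := heqs.
have {}E1 := E1 _ pW; have {}E2 := E2 _ qW; have {}E3 := E3 _ uW.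
have {}E5 := E5 _ uhM.
have [uha uhb] := uhM.
have dU := derive1_represents uU; have dP := derive1_represents pP.
have dQ := derive1_represents qQ.
have Fr : represents x (fun y => p y + flux beta m (u y))
    (fun i => P i + (flux_poly \Po U i)).
  move=> i y yi; rewrite hornerD horner_comp horner_flux_poly.
  by rewrite (pP i)// (uU i).
(* F(u) u_x is the derivative of G(u). *)
have I0 : inner x (fun y => p y + flux beta m (u y)) (derive1 u) =
    inner x p (derive1 u) +
    bracket (fun i s => flux_primitive.[trace x u i s]) (fun _ _ => 1).
  rewrite (trace_represents hx uU) (inner_represents Fr dU).
  rewrite (inner_represents pP dU) -big_split /=.
  apply: eq_bigr => i _; rewrite mulrDl elt_intD; congr (_ + _).
  rewrite -deriv_flux_primitive -deriv_comp (elt_int_deriv hx).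
  by rewrite !horner_comp /normal; ring.
have I1 : inner x p (derive1 u) + inner x u (derive1 p) =
    bracket (trace x u) (trace x p).
  rewrite (trace_represents hx uU) (trace_represents hx pP).
  rewrite (inner_represents pP dU) (inner_represents uU dP) -big_split /=.
  apply: eq_bigr => i _; rewrite -elt_intD addrC [P i * _]mulrC addrC -derivM.
  rewrite (elt_int_deriv hx).
  by rewrite !hornerM /normal; ring.
have I2 : inner x q (derive1 q) + inner x q (derive1 q) =
    bracket (trace x q) (trace x q).
  rewrite (trace_represents hx qQ) (inner_represents qQ dQ) -big_split /=.
  apply: eq_bigr => i _; rewrite -elt_intD {1}[Q i * _]mulrC -derivM.
  rewrite (elt_int_deriv hx).
  by rewrite !hornerM /normal; ring.
have I3 : inner x p q = inner x q p.
  rewrite (inner_represents pP qQ) (inner_represents qQ pP).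
  by apply: eq_bigr => i _; rewrite mulrC.
have T := bracket_telescope (fun j => flux_primitive.[uh j]).
rewrite uha uhb subrr in T.
rewrite -/qhat in E2; rewrite -/phat in E3 E5.
rewrite /dissipation /jump bracket_dissipation E5 T.
move: E1 E2 E3 I0 I1 I2; rewrite I3.
move: (inner x q p) (inner x u (derive1 p)) (inner x q (derive1 q))
  (inner x ut u) (inner x _ (derive1 u)) (inner x p (derive1 u)) (inner x f u).
move: (bracket _ (trace x p)) (bracket _ (trace x p)) (bracket _ (trace x q))
  (bracket _ (trace x q)) (bracket _ (trace x u)) (bracket _ (fun _ _ => 1))
  (bracket qhat qhat).
by move=> *; lra.
Qed.

(** The expansion of G(u) around uh with its exact remainder; n^2 = 1 moves the
normal from one side to the other. *)
Lemma flux_primitive_jump i s :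
  flux_primitive.[trace x u i s] - flux_primitive.[to_bfun uh i s] =
  flux beta m (to_bfun uh i s) * jump i s
  + tau_tilde x beta m u uh i s * jump i s ^+ 2 * normal R i s.
Proof.
rewrite tau_tilde_sqr -[_ * normal R i s * _]mulrA.
have -> : normal R i s * normal R i s = 1 by case: s; rewrite /normal; ring.
by rewrite /jump; ring.
Qed.

Hypothesis hplus : forall i,
  0 <= (tau_F tau uh u i Plus - tau_tilde x beta m u uh i Plus)
       - tau_pu tau i - 2^-1 * tau_qu tau i Plus ^+ 2.
Hypothesis hminus2 : forall i,
  0 <= (tau_F tau uh u i Minus - tau_tilde x beta m u uh i Minus)
         * tau_qp tau i ^+ 2
       + tau_qu tau i Minus * tau_qp tau i - 2^-1.

Lemma dissipation_Plus_le0 i : dissipation i Plus <= 0.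
Proof.
have := mulr_ge0 (hplus i) (sqr_ge0 (jump i Plus)).
rewrite -oppr_ge0; congr (_ <= _).
rewrite /dissipation flux_primitive_jump /F_hat /phat /qhat /p_hat /q_hat.
by rewrite -[to_bfun uh i Plus - _]opprB -/(jump i Plus) /normal; field.
Qed.

Lemma dissipation_Minus_ge0 i : 0 <= dissipation i Minus.
Proof.
have := quadratic_form_ge0 (phm i - trace x p i Minus) (jump i Minus)
  (hminus2 i).
congr (_ <= _).
rewrite /dissipation flux_primitive_jump /F_hat /phat /qhat /p_hat /q_hat.
by rewrite -[to_bfun uh i Minus - _]opprB -/(jump i Minus) /normal; ring.
Qed.

Lemma energy_inequality : inner x ut u <= inner x f u.
Proof.
rewrite -subr_ge0 energy_identity subr_ge0.
have [_ _ _ E4 _] := heqs.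
apply: (@le_trans _ _ 0).
  rewrite pmulr_rle0 ?invr_gt0//; apply: bracket_self_le0 => mu.
  by rewrite E4 mul0r.
rewrite /bracket; apply: sumr_ge0 => i _.
have := dissipation_Plus_le0 i; have := dissipation_Minus_ge0 i.
by rewrite /normal; lra.
Qed.

End FixedTime.
End Stability.

(** * The stability theorem *)

Theorem theorem2p1 (R : realType) (a b T : R) (hab : a < b) (hT : 0 < T)
    (beta : R) (m k N : nat) (x : nfun R N) (hx : is_mesh a b x)
    (f : R -> R -> R) (hf : forall t : R, 0 < t <= T -> L2 a b (f t))
    (tau : stabilization R N)
    (u q p : R -> R -> R) (uh : R -> nfun R N) (phm : R -> 'I_N -> R)
    (hsol : hdg_solution x beta m tau a b T k f
              (fun _ _ => 0) (fun _ => 0) u q p uh phm)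
    (hplus : forall (t : R) (i : 'I_N), 0 < t <= T ->
       0 <= (tau_F tau (uh t) (u t) i Plus
             - tau_tilde x beta m (u t) (uh t) i Plus)
            - tau_pu tau i - 2^-1 * tau_qu tau i Plus ^+ 2)
    (hminus1 : forall (t : R) (i : 'I_N), 0 < t <= T ->
       0 <= (tau_F tau (uh t) (u t) i Minus
             - tau_tilde x beta m (u t) (uh t) i Minus)
            + 2^-1 * tau_qu tau i Minus ^+ 2)
    (hminus2 : forall (t : R) (i : 'I_N), 0 < t <= T ->
       0 <= (tau_F tau (uh t) (u t) i Minus
             - tau_tilde x beta m (u t) (uh t) i Minus) * tau_qp tau i ^+ 2
            + tau_qu tau i Minus * tau_qp tau i - 2^-1) :
  forall t : R, 0 < t <= T ->
    tderivable T (fun s => L2norm a b (u s) ^+ 2) t /\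
    tderiv T (fun s => L2norm a b (u s) ^+ 2) t <= 2 * inner x (f t) (u t).
Proof.
move=> t ht.
have uW (s : R) : 0 < s <= T -> Wh a b x k (u s) by move=> /hsol[[]].
have [[ut qt pt] uhM ud heqs] := hsol _ ht.
have [dE ->] := tquot_lim ht (tquot_L2norm_sqr hx ht uW ud).
split=> //; rewrite ler_pM2l//.
apply: (energy_inequality hx ut qt pt uhM heqs).
- by move=> i; exact: hplus.
- by move=> i; exact: hminus2.
Qed.
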